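(* Let $R$ be a ring and let $\mathcal{C}$ be an $R$-coring. Then the following are equivalent. (1) $\mathcal{C}$ is semicosplit. (2) The coring counit $\varepsilon_{\mathcal{C}}:\mathcal{C}\to R$ is regular as a morphism of $R$-bimodules. (3) There exists an invariant element $z\in\mathcal{C}^R$ such that $\varepsilon_{\mathcal{C}}(z)\varepsilon_{\mathcal{C}}(c)=\varepsilon_{\mathcal{C}}(c)$ (equivalently such that $\varepsilon_{\mathcal{C}}(z)c=c$), for every $c\in\mathcal{C}$.
   Context: Rings are unital and associative. An $R$-coring is an $R$-bimodule $\mathcal{C}$ with $R$-bimodule maps $\Delta_{\mathcal{C}}:\mathcal{C}\to\mathcal{C}\otimes_R\mathcal{C}$ and $\varepsilon_{\mathcal{C}}:\mathcal{C}\to R$ that are coassociative and counital. A right $\mathcal{C}$-comodule is a right $R$-module $M$ with a right $R$-linear coassociative, counital coaction $\rho_M:M\to M\otimes_R\mathcal{C}$; $\mathcal{M}^{\mathcal{C}}$ is the category of right $\mathcal{C}$-comodules. $\mathcal{C}^R=\{c\in\mathcal{C}\mid rc=cr\ \forall r\in R\}$. The induction functor is $G=(-)\otimes_R\mathcal{C}:\mathrm{Mod}\text{-}R\to\mathcal{M}^{\mathcal{C}}$, $M\mapsto M\otimes_R\mathcal{C}$ with coaction $M\otimes_R\Delta_{\mathcal{C}}$. The coring $\mathcal{C}$ is semicosplit if $G$ is semiseparable. For a functor $F:\mathcal{A}\to\mathcal{B}$ let $\mathcal{F}^F:\mathrm{Hom}_{\mathcal{A}}(-,-)\to\mathrm{Hom}_{\mathcal{B}}(F-,F-)$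 be the natural transformation (of functors $\mathcal{A}^{\mathrm{op}}\times\mathcal{A}\to\mathsf{Set}$) with $\mathcal{F}^F_{X,Y}(f)=F(f)$. $F$ is semiseparable if there is a natural transformation $\mathcal{P}^F:\mathrm{Hom}_{\mathcal{B}}(F-,F-)\to\mathrm{Hom}_{\mathcal{A}}(-,-)$ with $\mathcal{F}^F\circ\mathcal{P}^F\circ\mathcal{F}^F=\mathcal{F}^F$. A morphism $f$ in a category is regular if there is a morphism $g$ in that category with $f\circ g\circ f=f$. *)

(* Defs.v *)
From HB Require Import structures.
From mathcomp Require Import all_boot all_algebra.
From mathcomp Require Import freeg.
From mathcomp Require Import boolp.

Set Implicit Arguments.
Unset Strict Implicit.
Unset Printing Implicit Defensive.

Import GRing.Theory.
Local Open Scope ring_scope.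

(* Morphisms are compared with Leibniz equality; for the concrete categories  *)
(* below this is pointwise equality, by functional extensionality and proof   *)
(* irrelevance.                                                               *)

Record category := Category {
  obj :> Type;
  hom : obj -> obj -> Type;
  idm : forall X, hom X X;
  compm : forall X Y Z, hom Y Z -> hom X Y -> hom X Z;
  compA : forall X Y Z W (h : hom Z W) (g : hom Y Z) (f : hom X Y),
    compm h (compm g f) = compm (compm h g) f;
  comp1m : forall X Y (f : hom X Y), compm (idm Y) f = f;
  compm1 : forall X Y (f : hom X Y), compm f (idm X) = f
}.
Arguments hom {_} X Y.
Arguments idm {_} X.
Arguments compm {_ X Y Z} g f.

Record functor (A B : category) := Functor {
  fobj :> A -> B;
  fmap : forall X Y : A, hom X Y -> hom (fobj X) (fobj Y);
  fmap1 : forall X, fmap (idm X) = idm (fobj X);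
  fmapM : forall X Y Z (g : hom Y Z) (f : hom X Y),
    fmap (compm g f) = compm (fmap g) (fmap f)
}.
Arguments fmap {A B} F {X Y} f : rename.

(* P is a natural transformation Hom_B(F-,F-) -> Hom_A(-,-) between functors  *)
(* A^op x A -> Set.                                                           *)
Definition hom_natural (A B : category) (F : functor A B)
    (P : forall X Y : A, hom (F X) (F Y) -> hom X Y) : Prop :=
  forall (X X' Y Y' : A) (h : hom X' X) (k : hom Y Y') (g : hom (F X) (F Y)),
    P X' Y' (compm (fmap F k) (compm g (fmap F h))) = compm k (compm (P X Y g) h).

Arguments hom_natural {A B} F P.

Definition semiseparable (A B : category) (F : functor A B) : Prop :=
  exists P : forall X Y : A, hom (F X) (F Y) -> hom X Y,
    hom_natural F P /\
    forall (X Y : A) (f : hom X Y), fmap F (P X Y (fmap F f)) = fmap F f.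

Definition regular_mor (A : category) (X Y : A) (f : hom X Y) : Prop :=
  exists g : hom Y X, compm f (compm g f) = f.

HB.mixin Record isRmodule (R : pzRingType) M of GRing.Zmodule M := {
  rscale : M -> R -> M;
  rscaleA : forall m a b, rscale (rscale m a) b = rscale m (a * b);
  rscaler1 : forall m, rscale m 1 = m;
  rscaleDl : forall m n a, rscale (m + n) a = rscale m a + rscale n a;
  rscaleDr : forall m a b, rscale m (a + b) = rscale m a + rscale m b
}.

#[short(type="rmodType")]
HB.structure Definition Rmodule (R : pzRingType) :=
  { M of GRing.Zmodule M & isRmodule R M }.

Notation "m :* a" := (rscale m a) : ring_scope.

HB.mixin Record isBimodule (R : pzRingType) M
    of GRing.Lmodule R M & Rmodule R M := {
  scale_rscale : forall (a : R) (m : M) (b : R), a *: (m :* b) = (a *: m) :* b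
}.

#[short(type="bimodType")]
HB.structure Definition Bimodule (R : pzRingType) :=
  { M of GRing.Lmodule R M & Rmodule R M & isBimodule R M }.

HB.mixin Record isRScalable (R : pzRingType) (U V : rmodType R) (f : U -> V) := {
  rscalable_subproof : forall (u : U) (a : R), f (u :* a) = f u :* a
}.

#[short(type="rlinearType")]
HB.structure Definition RLinear (R : pzRingType) (U V : rmodType R) :=
  { f of GRing.isNmodMorphism U V f & isRScalable R U V f }.

#[short(type="bimodMorType")]
HB.structure Definition BimodMor (R : pzRingType) (U V : bimodType R) :=
  { f of @GRing.Linear R U V *:%R f & isRScalable R U V f }.

Notation "{ 'rlinear' U -> V }" := (rlinearType U%type V%type)
  (U at level 98, V at level 99, format "{ 'rlinear'  U  ->  V }") : type_scope.
Notation "{ 'bimod' U -> V }" := (bimodMorType U%type V%type)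
  (U at level 98, V at level 99, format "{ 'bimod'  U  ->  V }") : type_scope.

Section RscaleTheory.
Variables (R : pzRingType) (U V : rmodType R).

Lemma rlinearZ (f : {rlinear U -> V}) u a : f (u :* a) = f u :* a.
Proof. exact: rscalable_subproof. Qed.

Lemma rlinear_eq (f g : {rlinear U -> V}) : f =1 g -> f = g.
Proof.
case: f g => [f [[cf] [sf]]] [g [[cg] [sg]]] /= /funext fg; subst g.
by rewrite (Prop_irrelevance cf cg) (Prop_irrelevance sf sg).
Qed.

End RscaleTheory.

Lemma bimod_rlinearZ (R : pzRingType) (U V : bimodType R) (f : {bimod U -> V}) u a :
  f (u :* a) = f u :* a.
Proof. exact: rscalable_subproof. Qed.

Lemma bimod_eq (R : pzRingType) (U V : bimodType R) (f g : {bimod U -> V}) :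
  f =1 g -> f = g.
Proof.
case: f g => [f [[cf] [lf] [sf]]] [g [[cg] [lg] [sg]]] /= /funext fg; subst g.
by rewrite (Prop_irrelevance cf cg) (Prop_irrelevance lf lg)
           (Prop_irrelevance sf sg).
Qed.

Section IdComp.
Variable R : pzRingType.

Section Rmod.
Variables U V W : rmodType R.
Lemma idfun_rscalable (u : U) (a : R) : idfun (u :* a) = idfun u :* a.
Proof. by []. Qed.
HB.instance Definition _ := isRScalable.Build R U U idfun idfun_rscalable.
Variables (g : {rlinear V -> W}) (f : {rlinear U -> V}).
Lemma comp_rscalable (u : U) (a : R) : (g \o f) (u :* a) = (g \o f) u :* a.
Proof. by rewrite /= !rlinearZ. Qed.
HB.instance Definition _ := isRScalable.Build R U W (g \o f) comp_rscalable.
End Rmod.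

Section Bimod.
Variables U V W : bimodType R.
HB.instance Definition _ :=
  isRScalable.Build R U U idfun (@idfun_rscalable U).
Variables (g : {bimod V -> W}) (f : {bimod U -> V}).
HB.instance Definition _ :=
  isRScalable.Build R U W (g \o f) (comp_rscalable g f).
End Bimod.
End IdComp.

Section RegularBimodule.
Variable R : pzRingType.

Lemma reg_rscaleA (x : R^o) (a b : R) : x * a * b = x * (a * b).
Proof. by rewrite mulrA. Qed.
HB.instance Definition _ :=
  @isRmodule.Build R R^o (fun (x : R^o) (a : R) => x * a)
    reg_rscaleA (@mulr1 R) (@mulrDl R) (@mulrDr R).
Lemma reg_scale_rscale (a : R) (x : R^o) (b : R) : a *: (x :* b) = (a *: x) :* b.
Proof. exact: mulrA. Qed.
HB.instance Definition _ := isBimodule.Build R R^o reg_scale_rscale.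

End RegularBimodule.

Record balanced (R : pzRingType) (M : rmodType R) (N : lmodType R)
    (A : zmodType) (f : M -> N -> A) : Prop := Balanced {
  balDl : forall m m' n, f (m + m') n = f m n + f m' n;
  balDr : forall m n n', f m (n + n') = f m n + f m n';
  balZ : forall m a n, f (m :* a) n = f m (a *: n)
}.

Section Tensor.
Variables (R : pzRingType) (M : rmodType R) (N : lmodType R).

Local Notation free := {freeg (M * N)%type / int}.
Local Notation "<| m , n |>" := [freeg [:: (1%R, (m, n))]] : ring_scope.

Inductive tensor_rel : free -> Prop :=
| TensorRel0 : tensor_rel 0
| TensorRelB x y : tensor_rel x -> tensor_rel y -> tensor_rel (x - y)
| TensorRelDl m m' n : tensor_rel (<| m + m', n |> - (<| m, n |> + <| m', n |>))
| TensorRelDr m n n' : tensor_rel (<| m, n + n' |> - (<| m, n |> + <| m, n' |>))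
| TensorRelZ m a n : tensor_rel (<| m :* a, n |> - <| m, a *: n |>).

Definition tensor_relb : {pred free} := [pred x | `[< tensor_rel x >]].

Fact tensor_relb_closed : zmod_closed tensor_relb.
Proof.
split=> [|x y]; rewrite !inE; first by apply/asboolP; exact: TensorRel0.
by move=> /asboolP hx /asboolP hy; apply/asboolP; exact: TensorRelB.
Qed.

HB.instance Definition _ :=
  GRing.isZmodClosed.Build free tensor_relb tensor_relb_closed.

Definition tensor : Type := Quotient.quot tensor_relb.
HB.instance Definition _ := GRing.Zmodule.on tensor.
HB.instance Definition _ := ZmodQuotient.on tensor.

Definition tens (m : M) (n : N) : tensor := (\pi_tensor <| m, n |>)%qT.

(* The map out of the tensor product induced by f; only meaningful when f is  *)
(* balanced.                                                                  *)
Definition tensor_lift (A : zmodType) (f : M -> N -> A) (t : tensor) : A :=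
  fglift (fun mn : M * N => f mn.1 mn.2 : zmodule A) (repr t).

Lemma tens0l n : tens 0 n = 0.
Proof.
suff /eqP: tens 0 n = tens 0 n + tens 0 n by rewrite -subr_eq0 opprD addNKr oppr_eq0 => /eqP.
rewrite /tens -raddfD; apply/eqP; rewrite -Quotient.idealrBE !inE.
by apply/asboolP; rewrite -[in X in X - _](addr0 0); exact: TensorRelDl.
Qed.

Lemma tensDl m m' n : tens (m + m') n = tens m n + tens m' n.
Proof.
rewrite /tens -raddfD; apply/eqP; rewrite -Quotient.idealrBE !inE.
by apply/asboolP; exact: TensorRelDl.
Qed.

Lemma tensDr m n n' : tens m (n + n') = tens m n + tens m n'.
Proof.
rewrite /tens -raddfD; apply/eqP; rewrite -Quotient.idealrBE !inE.
by apply/asboolP; exact: TensorRelDr.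
Qed.

Lemma tensZ m a n : tens (m :* a) n = tens m (a *: n).
Proof.
rewrite /tens; apply/eqP; rewrite -Quotient.idealrBE !inE.
by apply/asboolP; exact: TensorRelZ.
Qed.

Lemma tensNl m n : tens (- m) n = - tens m n.
Proof. by apply/eqP; rewrite -addr_eq0 -tensDl addNr tens0l. Qed.

Lemma tensor_ind (P : tensor -> Prop) :
  (forall m n, P (tens m n)) -> (forall s t, P s -> P t -> P (s + t)) ->
  forall t, P t.
Proof.
move=> Ptens PD t; rewrite -[t]reprK -[repr t]freeg_sumE raddf_sum.
have P0 : P 0 by rewrite -(tens0l 0).
elim/big_ind: _ => //= -[m n] _; move: (coeff _ _) => c.
have -> : << c *g (m, n) >> = << (m, n) >> *~ c :> free.
  by rewrite freegU_mulz; congr << _ *g _ >>; rewrite intz.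
rewrite raddfMz -/(tens m n).
have PMn k : P (tens m n *+ k).
  by elim: k => [|k IHk]; rewrite ?mulr0n // mulrS; apply: PD.
case: c => k; first exact: PMn.
rewrite NegzE mulrNz -pmulrn -mulNrn -tensNl.
by elim: k.+1 => [|j IHj]; rewrite ?mulr0n // mulrS; apply: PD.
Qed.

Section Lift.
Variables (A : zmodType) (f : M -> N -> A).
Hypothesis fbal : balanced f.

Let F := fglift (fun mn : M * N => f mn.1 mn.2 : zmodule A).
Let FB : {morph F : x y / x - y}. Proof. exact: lift_is_additive. Qed.
Let F0 : F 0 = 0. Proof. by rewrite -[0]subr0 FB subrr. Qed.
Let FD : {morph F : x y / x + y}.
Proof. by move=> x y; rewrite -[y in LHS]opprK -[- y]sub0r !FB F0 sub0r opprK. Qed.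
Let FU m n : F <| m, n |> = f m n. Proof. by rewrite /F liftU scale1r. Qed.

Let F_rel (x : free) : tensor_rel x -> F x = 0.
Proof.
elim=> [|{}x y _ Fx _ Fy|m m' n|m n n'|m a n].
- exact: F0.
- by rewrite FB Fx Fy subr0.
- by rewrite FB FD !FU (balDl fbal) subrr.
- by rewrite FB FD !FU (balDr fbal) subrr.
- by rewrite FB !FU (balZ fbal) subrr.
Qed.

Let F_pi (x : free) : tensor_lift f (\pi_tensor x)%qT = F x.
Proof.
apply/eqP; rewrite -subr_eq0 -[X in X - _]/(F _) -FB; apply/eqP/F_rel.
apply/asboolP; rewrite -[asbool _]/((_ : free) \in tensor_relb).
by rewrite Quotient.idealrBE reprK.
Qed.

Lemma tensor_liftE m n : tensor_lift f (tens m n) = f m n.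
Proof. by rewrite F_pi FU. Qed.

Lemma tensor_liftD s t :
  tensor_lift f (s + t) = tensor_lift f s + tensor_lift f t.
Proof.
by rewrite -[s]reprK -[t]reprK -raddfD !F_pi FD.
Qed.

End Lift.

Lemma tensor_ext (A : zmodType) (f g : tensor -> A) :
  {morph f : s t / s + t} -> {morph g : s t / s + t} ->
  (forall m n, f (tens m n) = g (tens m n)) -> f =1 g.
Proof.
move=> fD gD fg; elim/tensor_ind => [//|s t fs ft]; by rewrite fD gD fs ft.
Qed.

End Tensor.

Notation "m \ox n" := (tens m n) (at level 40, left associativity) : ring_scope.

Section TensorRmod.
Variables (R : pzRingType) (M : rmodType R) (N : bimodType R).
Local Notation MN := (tensor M N).

Definition tensor_rscale (t : MN) (a : R) : MN :=
  tensor_lift (fun m n => m \ox (n :* a)) t.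

Fact tensor_rscale_bal a : balanced (fun (m : M) (n : N) => m \ox (n :* a)).
Proof.
split=> *; first exact: tensDl.
- by rewrite rscaleDl tensDr.
- by rewrite tensZ scale_rscale.
Qed.

Fact tensor_rscale_tens a m n : tensor_rscale (m \ox n) a = m \ox (n :* a).
Proof. exact/tensor_liftE/tensor_rscale_bal. Qed.

Fact tensor_rscaleDl s t a :
  tensor_rscale (s + t) a = tensor_rscale s a + tensor_rscale t a.
Proof. exact/tensor_liftD/tensor_rscale_bal. Qed.

Fact tensor_rscaleA t a b :
  tensor_rscale (tensor_rscale t a) b = tensor_rscale t (a * b).
Proof.
elim/tensor_ind: t => [m n|s t IHs IHt]; last by rewrite !tensor_rscaleDl IHs IHt.
by rewrite !tensor_rscale_tens rscaleA.
Qed.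

Fact tensor_rscaler1 t : tensor_rscale t 1 = t.
Proof.
elim/tensor_ind: t => [m n|s t IHs IHt]; last by rewrite !tensor_rscaleDl IHs IHt.
by rewrite !tensor_rscale_tens rscaler1.
Qed.

Fact tensor_rscaleDr t a b :
  tensor_rscale t (a + b) = tensor_rscale t a + tensor_rscale t b.
Proof.
elim/tensor_ind: t => [m n|s t IHs IHt].
  by rewrite !tensor_rscale_tens rscaleDr tensDr.
by rewrite !tensor_rscaleDl IHs IHt addrACA.
Qed.

HB.instance Definition _ := isRmodule.Build R MN
  tensor_rscaleA tensor_rscaler1 tensor_rscaleDl tensor_rscaleDr.

Lemma tens_rscale m n a : (m \ox n : MN) :* a = m \ox (n :* a).
Proof. exact: tensor_rscale_tens. Qed.

End TensorRmod.

Section TensorLmod.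
Variables (R : pzRingType) (M : bimodType R) (N : lmodType R).
Local Notation MN := (tensor M N).

Definition tensor_scale (a : R) (t : MN) : MN :=
  tensor_lift (fun m n => (a *: m) \ox n) t.

Fact tensor_scale_bal a : balanced (fun (m : M) (n : N) => (a *: m) \ox n).
Proof.
split=> *; last by rewrite scale_rscale tensZ.
- by rewrite scalerDr tensDl.
- exact: tensDr.
Qed.

Fact tensor_scale_tens a m n : tensor_scale a (m \ox n) = (a *: m) \ox n.
Proof. exact/tensor_liftE/tensor_scale_bal. Qed.

Fact tensor_scaleDr a s t :
  tensor_scale a (s + t) = tensor_scale a s + tensor_scale a t.
Proof. exact/tensor_liftD/tensor_scale_bal. Qed.

Fact tensor_scaleA a b t :
  tensor_scale a (tensor_scale b t) = tensor_scale (a * b) t.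
Proof.
elim/tensor_ind: t => [m n|s t IHs IHt]; last by rewrite !tensor_scaleDr IHs IHt.
by rewrite !tensor_scale_tens scalerA.
Qed.

Fact tensor_scale1r t : tensor_scale 1 t = t.
Proof.
elim/tensor_ind: t => [m n|s t IHs IHt]; last by rewrite !tensor_scaleDr IHs IHt.
by rewrite !tensor_scale_tens scale1r.
Qed.

Fact tensor_scaleDl t a b :
  tensor_scale (a + b) t = tensor_scale a t + tensor_scale b t.
Proof.
elim/tensor_ind: t => [m n|s t IHs IHt].
  by rewrite !tensor_scale_tens scalerDl tensDl.
by rewrite !tensor_scaleDr IHs IHt addrACA.
Qed.

HB.instance Definition _ := GRing.Zmodule_isLmodule.Build R MN
  tensor_scaleA tensor_scale1r tensor_scaleDr tensor_scaleDl.

Lemma tens_scale m n a : a *: (m \ox n : MN) = (a *: m) \ox n.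
Proof. exact: tensor_scale_tens. Qed.

End TensorLmod.

Section TensorBimod.
Variables (R : pzRingType) (M N : bimodType R).
Local Notation MN := (tensor M N).

Fact tensor_scale_rscale (a : R) (t : MN) (b : R) :
  a *: (t :* b) = (a *: t) :* b.
Proof.
elim/tensor_ind: t => [m n|s t IHs IHt].
  by rewrite !(tens_scale, tens_rscale).
by rewrite scalerDr !rscaleDl scalerDr IHs IHt.
Qed.

HB.instance Definition _ := isBimodule.Build R MN tensor_scale_rscale.

End TensorBimod.

Section TensorMap.
Variables (R : pzRingType) (M M' : rmodType R) (N N' : lmodType R).
Variables (f : {rlinear M -> M'}) (g : {linear N -> N'}).

Definition tensor_map : tensor M N -> tensor M' N' :=
  tensor_lift (fun m n => f m \ox g n).

Fact tensor_map_bal : balanced (fun (m : M) (n : N) => f m \ox g n).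
Proof.
split=> *; first by rewrite raddfD tensDl.
- by rewrite raddfD tensDr.
- by rewrite rlinearZ tensZ linearZ.
Qed.

Lemma tensor_mapE m n : tensor_map (m \ox n) = f m \ox g n.
Proof. exact/tensor_liftE/tensor_map_bal. Qed.

Lemma tensor_mapD s t : tensor_map (s + t) = tensor_map s + tensor_map t.
Proof. exact/tensor_liftD/tensor_map_bal. Qed.

End TensorMap.

(* The canonical isomorphism M (x) (N (x) P) -> (M (x) N) (x) P: coassociativity *)
(* is stated in (M (x) N) (x) P.                                              *)
Section TensorAssoc.
Variables (R : pzRingType) (M : rmodType R) (N : bimodType R) (P : lmodType R).

Definition tensor_assoc : tensor M (tensor N P) -> tensor (tensor M N) P :=
  tensor_lift (fun m => tensor_lift (fun n p => (m \ox n) \ox p)).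

Fact tensor_assoc_bal_in m : balanced (fun (n : N) (p : P) => (m \ox n : tensor M N) \ox p).
Proof.
split=> *; first by rewrite tensDr tensDl.
- by rewrite tensDr.
- by rewrite -tens_rscale tensZ.
Qed.

Fact tensor_assoc_bal :
  balanced (fun (m : M) => tensor_lift (fun (n : N) (p : P) => (m \ox n) \ox p)).
Proof.
have LE m := tensor_liftE (tensor_assoc_bal_in m).
have LD m := tensor_liftD (tensor_assoc_bal_in m).
split=> [m m' t|m s t|m a t].
- elim/tensor_ind: t => [n p|s t IHs IHt]; first by rewrite !LE !tensDl.
  by rewrite !LD IHs IHt addrACA.
- exact: LD.
- elim/tensor_ind: t => [n p|s t IHs IHt]; first by rewrite tens_scale !LE tensZ.
  by rewrite scalerDr !LD IHs IHt.
Qed.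

Lemma tensor_assocD s t :
  tensor_assoc (s + t) = tensor_assoc s + tensor_assoc t.
Proof. exact/tensor_liftD/tensor_assoc_bal. Qed.

Lemma tensor_assocE m n p : tensor_assoc (m \ox (n \ox p)) = (m \ox n) \ox p.
Proof.
by rewrite [LHS](tensor_liftE tensor_assoc_bal) (tensor_liftE (tensor_assoc_bal_in m)).
Qed.

End TensorAssoc.

(* The canonical isomorphisms R (x) N -> N and M (x) R -> M.                  *)
Section TensorUnit.
Variable R : pzRingType.

Definition tensor_lunit (N : lmodType R) : tensor R^o N -> N :=
  tensor_lift (fun (a : R^o) (n : N) => (a : R) *: n).

Definition tensor_runit (M : rmodType R) : tensor M R^o -> M :=
  tensor_lift (fun (m : M) (a : R^o) => m :* (a : R)).

Fact tensor_lunit_bal (N : lmodType R) :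
  balanced (fun (a : R^o) (n : N) => (a : R) *: n).
Proof.
by split=> [a b n|a n n'|a b n]; rewrite ?scalerDl ?scalerDr // scalerA.
Qed.

Fact tensor_runit_bal (M : rmodType R) :
  balanced (fun (m : M) (a : R^o) => m :* (a : R)).
Proof.
by split=> [m m' a|m a b|m a b]; rewrite ?rscaleDl ?rscaleDr // rscaleA.
Qed.

Lemma tensor_lunitE (N : lmodType R) (a : R) (n : N) :
  tensor_lunit ((a : R^o) \ox n) = a *: n.
Proof. exact: (tensor_liftE (tensor_lunit_bal N)). Qed.

Lemma tensor_lunitD (N : lmodType R) (s t : tensor R^o N) :
  tensor_lunit (s + t) = tensor_lunit s + tensor_lunit t.
Proof. exact: (tensor_liftD (tensor_lunit_bal N)). Qed.

Lemma tensor_runitE (M : rmodType R) (m : M) (a : R) :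
  tensor_runit (m \ox (a : R^o)) = m :* a.
Proof. exact: (tensor_liftE (tensor_runit_bal M)). Qed.

Lemma tensor_runitD (M : rmodType R) (s t : tensor M R^o) :
  tensor_runit (s + t) = tensor_runit s + tensor_runit t.
Proof. exact: (tensor_liftD (tensor_runit_bal M)). Qed.

End TensorUnit.

Record coring (R : pzRingType) := Coring {
  coring_bimod :> bimodType R;
  comul : {bimod coring_bimod -> tensor coring_bimod coring_bimod};
  counit : {bimod coring_bimod -> R^o};
  comulA : forall c,
    tensor_map comul idfun (comul c) = tensor_assoc (tensor_map idfun comul (comul c));
  comul_counitl : forall c, tensor_lunit (tensor_map counit idfun (comul c)) = c;
  comul_counitr : forall c, tensor_runit (tensor_map idfun counit (comul c)) = c
}.
Arguments comul {R} C : rename.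
Arguments counit {R} C : rename.

Record comodule (R : pzRingType) (C : coring R) := Comodule {
  comodule_rmod :> rmodType R;
  coact : {rlinear comodule_rmod -> tensor comodule_rmod C};
  coactA : forall m,
    tensor_map coact idfun (coact m)
      = tensor_assoc (tensor_map idfun (comul C) (coact m));
  coact_counit : forall m, tensor_runit (tensor_map idfun (counit C) (coact m)) = m
}.
Arguments coact {R C} M : rename.

Record comodule_hom (R : pzRingType) (C : coring R) (M N : comodule C) :=
  ComoduleHom {
  comodule_hom_fun :> {rlinear M -> N};
  comodule_homP : forall m,
    coact N (comodule_hom_fun m) = tensor_map comodule_hom_fun idfun (coact M m)
}.

Lemma morphD_nmod (U V : zmodType) (f : U -> V) :
  (forall x y, f (x + y) = f x + f y) -> nmod_morphism f.
Proof. by move=> fD; split=> //; apply: (addrI (f 0)); rewrite -fD !addr0. Qed.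

Section Categories.
Variable R : pzRingType.

Definition rlinear_comp (M N P : rmodType R) (g : {rlinear N -> P})
  (f : {rlinear M -> N}) : {rlinear M -> P} := g \o f.

Definition bimod_comp (M N P : bimodType R) (g : {bimod N -> P})
  (f : {bimod M -> N}) : {bimod M -> P} := g \o f.

Definition rmod_cat : category.
Proof.
refine (@Category (rmodType R) (fun M N => {rlinear M -> N})
  (fun M => idfun) rlinear_comp _ _ _) => *; exact: rlinear_eq.
Defined.

Definition bimod_cat : category.
Proof.
refine (@Category (bimodType R) (fun M N => {bimod M -> N})
  (fun M => idfun) bimod_comp _ _ _) => *; exact: bimod_eq.
Defined.

Variable C : coring R.
Implicit Types M N P : comodule C.

Lemma comodule_hom_eq M N (f g : comodule_hom M N) : f =1 g -> f = g.
Proof.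
case: f g => [f fP] [g gP] /= /rlinear_eq fg; subst g.
by rewrite (Prop_irrelevance fP gP).
Qed.

Fact tensor_map_id (M : rmodType R) (N : lmodType R) (t : tensor M N) :
  tensor_map idfun idfun t = t.
Proof. 
by elim/tensor_ind: t => [m n|s t IHs IHt]; rewrite ?tensor_mapE // tensor_mapD IHs IHt.
Qed.

Fact tensor_map_comp (M M' M'' : rmodType R) (N : lmodType R)
    (g : {rlinear M' -> M''}) (f : {rlinear M -> M'}) (t : tensor M N) :
  tensor_map (g \o f) idfun t = tensor_map g idfun (tensor_map f idfun t).
Proof.
elim/tensor_ind: t => [m n|s t IHs IHt]; first by rewrite !tensor_mapE.
by rewrite !tensor_mapD IHs IHt.
Qed.

Definition comodule_id M : comodule_hom M M :=
  @ComoduleHom R C M M idfun (fun m => esym (tensor_map_id _)).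

Fact comodule_comp_subproof M N P (g : comodule_hom N P) (f : comodule_hom M N) m :
  coact P ((g \o f) m) = tensor_map (g \o f) idfun (coact M m).
Proof. by rewrite /= !comodule_homP tensor_map_comp. Qed.

Definition comodule_comp M N P (g : comodule_hom N P) (f : comodule_hom M N) :=
  ComoduleHom (comodule_comp_subproof g f).

Definition comodule_cat : category.
Proof.
refine (@Category (comodule C) (@comodule_hom R C)
  comodule_id comodule_comp _ _ _) => *; exact: comodule_hom_eq.
Defined.

End Categories.

Section TensorMapRlinear.
Variables (R : pzRingType) (M M' : rmodType R) (N N' : bimodType R).
Variables (f : {rlinear M -> M'}) (g : {bimod N -> N'}).

Fact tensor_map_is_nmod_morphism : nmod_morphism (tensor_map f g).
Proof. exact/morphD_nmod/tensor_mapD. Qed.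
HB.instance Definition _ :=
  GRing.isNmodMorphism.Build _ _ (tensor_map f g) tensor_map_is_nmod_morphism.

Fact tensor_map_rscalable (t : tensor M N) (a : R) :
  tensor_map f g (t :* a) = tensor_map f g t :* a.
Proof.
elim/tensor_ind: t => [m n|s t IHs IHt]; last first.
  by rewrite rscaleDl !tensor_mapD rscaleDl IHs IHt.
by rewrite tens_rscale !tensor_mapE tens_rscale; congr (_ \ox _); exact: bimod_rlinearZ.
Qed.
HB.instance Definition _ :=
  isRScalable.Build R _ _ (tensor_map f g) tensor_map_rscalable.

End TensorMapRlinear.

Section TensorAssocRlinear.
Variables (R : pzRingType) (M : rmodType R) (N P : bimodType R).

Fact tensor_assoc_is_nmod_morphism : nmod_morphism (@tensor_assoc R M N P).
Proof. exact/morphD_nmod/tensor_assocD. Qed.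
HB.instance Definition _ := GRing.isNmodMorphism.Build _ _
  (@tensor_assoc R M N P) tensor_assoc_is_nmod_morphism.

Fact tensor_assoc_rscalable (t : tensor M (tensor N P)) (a : R) :
  tensor_assoc (t :* a) = tensor_assoc t :* a.
Proof.
elim/tensor_ind: t => [m u|s t IHs IHt]; last first.
  by rewrite rscaleDl !tensor_assocD rscaleDl IHs IHt.
rewrite tens_rscale; elim/tensor_ind: u => [n p|s t IHs IHt]; last first.
  by rewrite rscaleDl !tensDr !tensor_assocD rscaleDl IHs IHt.
by rewrite tens_rscale !tensor_assocE tens_rscale.
Qed.
HB.instance Definition _ :=
  isRScalable.Build R _ _ (@tensor_assoc R M N P) tensor_assoc_rscalable.

End TensorAssocRlinear.

Section Induction.
Variables (R : pzRingType) (C : coring R).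

Section Obj.
Variable M : rmodType R.

Definition ind_coact : {rlinear tensor M C -> tensor (tensor M C) C} :=
  @tensor_assoc R M C C \o tensor_map idfun (comul C).

Fact ind_coactE m c : ind_coact (m \ox c) = tensor_assoc (m \ox comul C c).
Proof. by rewrite /ind_coact /= tensor_mapE. Qed.

Let F m : tensor (tensor C C) C -> tensor (tensor (tensor M C) C) C :=
  tensor_lift (fun (u : tensor C C) (q : C) => tensor_assoc (m \ox u) \ox q).

Fact ind_coactA_bal m :
  balanced (fun (u : tensor C C) (q : C) =>
    (tensor_assoc (m \ox u) : tensor (tensor M C) C) \ox q).
Proof.
split=> [u v q|u p q|u a q]; first by rewrite tensDr tensor_assocD tensDl.
- by rewrite tensDr.
- by rewrite -tens_rscale tensor_assoc_rscalable tensZ.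
Qed.

Let FE m u q : F m (u \ox q) = tensor_assoc (m \ox u) \ox q.
Proof. exact: (tensor_liftE (ind_coactA_bal m)). Qed.

Let FD m : {morph F m : s t / s + t}.
Proof. exact: (tensor_liftD (ind_coactA_bal m)). Qed.

Fact ind_coactA t :
  tensor_map ind_coact idfun (ind_coact t)
    = tensor_assoc (tensor_map idfun (comul C) (ind_coact t)).
Proof.
elim/tensor_ind: t => [m c|s t IHs IHt]; last first.
  by rewrite raddfD !tensor_mapD tensor_assocD IHs IHt.
rewrite ind_coactE; transitivity (F m (tensor_map (comul C) idfun (comul C c))).
  elim/tensor_ind: (comul C c) => [p q|s t IHs IHt]; last first.
    by rewrite tensDr tensor_assocD !tensor_mapD FD IHs IHt.
  by rewrite tensor_assocE !tensor_mapE FE ind_coactE.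
rewrite comulA; elim/tensor_ind: (comul C c) => [p q|s t IHs IHt]; last first.
  by rewrite tensDr tensor_assocD !tensor_mapD !tensor_assocD FD IHs IHt.
rewrite tensor_assocE !tensor_mapE /=.
elim/tensor_ind: (comul C q) => [c1 c2|s t IHs IHt]; last first.
  by rewrite !tensDr !tensor_assocD FD IHs IHt.
by rewrite !tensor_assocE FE tensor_assocE.
Qed.

Fact ind_coact_counit t :
  tensor_runit (tensor_map idfun (counit C) (ind_coact t)) = t.
Proof.
elim/tensor_ind: t => [m c|s t IHs IHt]; last first.
  by rewrite raddfD !tensor_mapD tensor_runitD IHs IHt.
rewrite ind_coactE -[X in _ = _ \ox X](comul_counitr c).
elim/tensor_ind: (comul C c) => [p q|s t IHs IHt]; last first.
  by rewrite tensDr tensor_assocD !tensor_mapD !tensor_runitD tensDr IHs IHt.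
by rewrite tensor_assocE !tensor_mapE !tensor_runitE tens_rscale.
Qed.

Definition ind_obj : comodule C := Comodule ind_coactA ind_coact_counit.

End Obj.

Section Mor.
Variables (M N : rmodType R) (f : {rlinear M -> N}).

Definition ind_mor_fun : {rlinear tensor M C -> tensor N C} := tensor_map f idfun.

Fact ind_morP t :
  coact (ind_obj N) (ind_mor_fun t)
    = tensor_map ind_mor_fun idfun (coact (ind_obj M) t).
Proof.
elim/tensor_ind: t => [m c|s t IHs IHt]; last first.
  rewrite [coact (ind_obj M) _]raddfD tensor_mapD -IHs -IHt.
  by rewrite [ind_mor_fun _]raddfD raddfD.
rewrite /= [ind_mor_fun _]tensor_mapE !tensor_mapE /=.
elim/tensor_ind: (comul C c) => [p q|s t IHs IHt]; last first.
  by rewrite !tensDr !tensor_assocD tensor_mapD IHs IHt.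
by rewrite !tensor_assocE !tensor_mapE [ind_mor_fun _]tensor_mapE.
Qed.

Definition ind_mor : comodule_hom (ind_obj M) (ind_obj N) :=
  @ComoduleHom R C (ind_obj M) (ind_obj N) ind_mor_fun ind_morP.

End Mor.

Definition induction : functor (rmod_cat R) (comodule_cat C).
Proof.
refine (@Functor (rmod_cat R) (comodule_cat C) ind_obj ind_mor _ _).
- by move=> M; apply: comodule_hom_eq => t; apply: tensor_map_id.
- by move=> M N P g f; apply: comodule_hom_eq => t; apply: tensor_map_comp.
Defined.

Definition semicosplit : Prop := semiseparable induction.

End Induction.

Definition bimod_invariant (R : pzRingType) (M : bimodType R) (m : M) : Prop :=
  forall r : R, r *: m = m :* r.

(* Main.v *)
(* The functor G = - (x) C is right adjoint to the forgetful functor, with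
   counit M (x) eps : M (x) C -> M and unit the coactions.  If P witnesses the
   semiseparability of G, then P applied to the coactions of the comodules
   M (x) C gives maps gamma_M : M -> M (x) C natural in M, and composing with
   the adjunction counit turns gamma_M into P(id); since G(P(id)) = id, the
   element z = gamma_R(1) is invariant and satisfies eps(z) c = c.  Conversely,
   such a z yields P(g)(m) = (N (x) eps)(g(m (x) z)). *)
Require Import Defs.
From HB Require Import structures.
From mathcomp Require Import all_boot all_algebra.

Import GRing.Theory.
Local Open Scope ring_scope.

Section Counit.
Context {R : pzRingType} (C : coring R).

(** By the left counit law every [c] is a sum of terms [counit C p *: q], and each of these is fixed
    by [counit C z]. Conversely, apply the left linear counit. *)
Lemma counit_unital (z : C) :
  (forall c : C, counit C z * counit C c = counit C c) <->
  (forall c : C, (counit C z : R) *: c = c).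
Proof.
split=> [zP c|zP c]; last by rewrite -[in RHS](zP c) linearZ.
have zt (t : tensor C C) : (counit C z : R) *: tensor_lunit (tensor_map (counit C) idfun t)
                         = tensor_lunit (tensor_map (counit C) idfun t).
  elim/tensor_ind: t => [p q|s t IHs IHt]; last first.
    by rewrite tensor_mapD tensor_lunitD scalerDr IHs IHt.
  by rewrite tensor_mapE tensor_lunitE scalerA zP.
by rewrite -[c]comul_counitl zt.
Qed.

End Counit.

Section RegularBimoduleMaps.
Context {R : pzRingType}.

Section Lmul.
Variable r : R.
(** Naturality is later tested against these endomorphisms of [R^o] as a right module, which is how
    the left action of [R] enters. *)
Definition reg_lmul (x : R^o) : R^o := r * (x : R).
Fact reg_lmul_nmod : nmod_morphism reg_lmul.
Proof. by apply: morphD_nmod => x y; exact: mulrDr. Qed.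
HB.instance Definition _ :=
  GRing.isNmodMorphism.Build _ _ reg_lmul reg_lmul_nmod.
Fact reg_lmul_rscalable (x : R^o) (a : R) : reg_lmul (x :* a) = reg_lmul x :* a.
Proof. exact: mulrA. Qed.
HB.instance Definition _ :=
  isRScalable.Build R R^o R^o reg_lmul reg_lmul_rscalable.
End Lmul.

Section InvariantMap.
Context {M : bimodType R} {z : M} (zinv : bimod_invariant z).
(* The unused proof argument lets the bimodule instances below be found by
   unification, although they hold only for invariant z. *)
Definition invariant_map of bimod_invariant z := fun r : R^o => (r : R) *: z.
Local Notation phi := (invariant_map zinv).
Fact invariant_map_nmod : nmod_morphism phi.
Proof. by apply: morphD_nmod => a b; exact: scalerDl. Qed.
HB.instance Definition _ :=
  GRing.isNmodMorphism.Build _ _ phi invariant_map_nmod.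
Fact invariant_map_scalable : scalable phi.
Proof. by move=> a b; rewrite /invariant_map scalerA. Qed.
HB.instance Definition _ :=
  GRing.isScalable.Build R R^o M *:%R phi invariant_map_scalable.
Fact invariant_map_rscalable (r : R^o) (a : R) : phi (r :* a) = phi r :* a.
Proof. by rewrite /invariant_map -scale_rscale -zinv scalerA. Qed.
HB.instance Definition _ :=
  isRScalable.Build R R^o M phi invariant_map_rscalable.
End InvariantMap.

(** Bimodule maps [g] from [R^o] to [C] correspond to invariant elements by evaluation at 1, and [g]
    composed with the counit sends [c] to [z :* counit C c]. *)
Lemma regular_counitP (C : coring R) :
  @regular_mor (bimod_cat R) C R^o (counit C) <->
  exists z : C, bimod_invariant z /\
    forall c : C, counit C z * counit C c = counit C c.
Proof.
split=> [[g gP]|[z [zinv zP]]].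
  pose g' : {bimod R^o -> C} := g.
  have gE (x : R^o) : g' x = g' 1 :* (x : R).
    rewrite -bimod_rlinearZ; congr (g' _); exact/esym/mul1r.
  exists (g' 1); split=> [r|c].
    by rewrite -gE -linearZ; congr (g' _); exact: mulr1.
  have gPc : counit C (g' (counit C c)) = counit C c.
    exact: (congr1 (fun h : {bimod C -> R^o} => h c) gP).
  by rewrite -[RHS]gPc [g' (_ c)]gE bimod_rlinearZ.
exists (invariant_map zinv : {bimod R^o -> C}).
apply: bimod_eq => c; rewrite /= /invariant_map zinv bimod_rlinearZ; exact: zP.
Qed.

End RegularBimoduleMaps.

Section TensorUnitRlinear.
Context {R : pzRingType} (M : rmodType R).
Fact tensor_runit_nmod : nmod_morphism (@tensor_runit R M).
Proof. exact/morphD_nmod/tensor_runitD. Qed.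
HB.instance Definition _ :=
  GRing.isNmodMorphism.Build _ _ (@tensor_runit R M) tensor_runit_nmod.
Fact tensor_runit_rscalable (t : tensor M R^o) (a : R) :
  tensor_runit (t :* a) = tensor_runit t :* a.
Proof.
elim/tensor_ind: t => [m r|s t IHs IHt]; last first.
  by rewrite rscaleDl !tensor_runitD rscaleDl IHs IHt.
by rewrite tens_rscale !tensor_runitE rscaleA.
Qed.
HB.instance Definition _ :=
  isRScalable.Build R _ _ (@tensor_runit R M) tensor_runit_rscalable.
End TensorUnitRlinear.

Section Adjunction.
Context {R : pzRingType} (C : coring R).

Definition ind_counit (M : rmodType R) : {rlinear tensor M C -> M} :=
  @tensor_runit R M \o tensor_map idfun (counit C).

Lemma ind_counitE (M : rmodType R) (m : M) (c : C) :
  ind_counit M (m \ox c) = m :* (counit C c : R).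
Proof. by rewrite /ind_counit /= tensor_mapE tensor_runitE. Qed.

Lemma ind_counitD (M : rmodType R) (s t : tensor M C) :
  ind_counit M (s + t) = ind_counit M s + ind_counit M t.
Proof. exact: raddfD. Qed.

Lemma ind_counit_natural (M N : rmodType R) (f : {rlinear M -> N})
    (t : tensor M C) :
  ind_counit N (tensor_map f idfun t) = f (ind_counit M t).
Proof.
elim/tensor_ind: t => [m c|s t IHs IHt]; last first.
  by rewrite tensor_mapD !ind_counitD raddfD IHs IHt.
by rewrite tensor_mapE !ind_counitE rlinearZ.
Qed.

Lemma counit_lunit (t : tensor R^o C) :
  counit C (tensor_lunit t) = ind_counit R^o t.
Proof.
elim/tensor_ind: t => [m c|s t IHs IHt]; last first.
  by rewrite tensor_lunitD ind_counitD -IHs -IHt raddfD.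
by rewrite tensor_lunitE ind_counitE linearZ.
Qed.

(** The unit of the adjunction at [N]; its colinearity is exactly coassociativity. *)
Definition coact_hom (N : comodule C) : comodule_hom N (ind_obj C N) :=
  @ComoduleHom R C N (ind_obj C N) (coact N) (fun n => esym (coactA n)).

(** A triangle identity of the adjunction, reduced to the left counit law by moving [counit C p]
    across the tensor sign. *)
Lemma ind_counit_coact (M : rmodType R) (t : tensor M C) :
  tensor_map (ind_counit M) idfun (coact (ind_obj C M) t) = t.
Proof.
elim/tensor_ind: t => [m c|s t IHs IHt]; last first.
  by rewrite raddfD tensor_mapD IHs IHt.
rewrite [coact _ _]ind_coactE -[in RHS](comul_counitl c).
elim/tensor_ind: (comul C c) => [p q|s t IHs IHt]; last first.
  by rewrite tensDr tensor_assocD !tensor_mapD tensor_lunitD tensDr IHs IHt.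
by rewrite tensor_assocE !tensor_mapE ind_counitE tensor_lunitE tensZ.
Qed.

Lemma lunit_rscale (t : tensor R^o C) (a : R) :
  tensor_lunit (t :* a) = tensor_lunit t :* a.
Proof.
elim/tensor_ind: t => [m c|s t IHs IHt]; last first.
  by rewrite rscaleDl !tensor_lunitD rscaleDl IHs IHt.
by rewrite tens_rscale !tensor_lunitE scale_rscale.
Qed.

Lemma lunit_lmul (a : R) (t : tensor R^o C) :
  tensor_lunit (tensor_map (reg_lmul a) idfun t) = a *: tensor_lunit t.
Proof.
elim/tensor_ind: t => [m c|s t IHs IHt]; last first.
  by rewrite tensor_mapD !tensor_lunitD scalerDr IHs IHt.
by rewrite tensor_mapE !tensor_lunitE scalerA.
Qed.

Lemma semicosplit_invariant :
  semicosplit C -> exists z : C, bimod_invariant z /\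
    forall c : C, (counit C z : R) *: c = c.
Proof.
case=> P [Pnat FPF].
pose RR : rmod_cat R := (R^o : rmodType R).
pose RC : rmod_cat R := (tensor R^o C : rmodType R).
pose rho : Defs.hom (induction C RR) (induction C RC) := coact_hom (ind_obj C R^o).
pose gamma : {rlinear R^o -> tensor R^o C} := P RR RC rho.
pose u : {rlinear R^o -> R^o} := P RR RR (idm (induction C RR)).
(* Naturality of [P] in its second variable along the adjunction counit, combined with the triangle
   identity. *)
have u_gamma x : u x = ind_counit R^o (gamma x).
  have := Pnat _ _ _ _ (idm RR) (ind_counit R^o : Defs.hom RC RR) rho.
  rewrite fmap1 !compm1.
  have -> : compm (fmap (induction C) (ind_counit R^o : Defs.hom RC RR)) rho
             = idm (induction C RR).
    by apply: comodule_hom_eq => t; exact: ind_counit_coact.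
  by move=> /(congr1 (fun h : {rlinear R^o -> R^o} => h x)).
(* Colinearity of [G(l)] turns precomposing [rho] with [G(l)] into postcomposing with [G(Gl)];
   naturality of [P] on each side then compares the two. *)
have gamma_lmul (r : R) (x : R^o) :
      gamma (reg_lmul r x) = tensor_map (reg_lmul r) idfun (gamma x).
  pose l : Defs.hom RR RR := (reg_lmul r : {rlinear R^o -> R^o}).
  pose Gl : Defs.hom RC RC := ind_mor_fun C (reg_lmul r).
  have := Pnat _ _ _ _ l (idm RC) rho; rewrite fmap1 !comp1m.
  have -> : compm rho (fmap (induction C) l) = compm (fmap (induction C) Gl) rho.
    by apply: comodule_hom_eq => t; exact: ind_morP.
  have := Pnat _ _ _ _ (idm RR) Gl rho; rewrite fmap1 !compm1 => ->.
  by move=> /(congr1 (fun h : {rlinear R^o -> tensor R^o C} => h x)).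
pose z := tensor_lunit (gamma 1).
exists z; split=> [r|c].
  (* Both [r *: z] and [z :* r] become the image of [gamma r], since [r * 1 = 1 * r]. *)
  rewrite -lunit_rscale -rlinearZ -lunit_lmul -gamma_lmul.
  congr (tensor_lunit (gamma _)); exact: etrans (mulr1 r) (esym (mul1r r)).
(* Now [counit C z] is [u 1], and semiseparability at the identity says [G(u)] is the identity;
   evaluate it at [1 \ox c]. *)
rewrite counit_lunit -u_gamma.
have := FPF RR RR (idm RR); rewrite fmap1.
move=> /(congr1 (fun h : comodule_hom (ind_obj C R^o) (ind_obj C R^o) =>
                   tensor_lunit (h ((1 : R^o) \ox c)))) /=.
by rewrite /ind_mor_fun tensor_mapE !tensor_lunitE scale1r.
Qed.

Section Retraction.
Context {z : C} (zinv : bimod_invariant z).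

Section Map.
Context {M N : rmodType R} (g : {rlinear tensor M C -> tensor N C}).
Definition retraction of bimod_invariant z :=
  fun m : M => ind_counit N (g (m \ox z)).
Local Notation phi := (retraction zinv).
Fact retraction_nmod : nmod_morphism phi.
Proof. by apply: morphD_nmod => m m'; rewrite /retraction tensDl !raddfD. Qed.
HB.instance Definition _ :=
  GRing.isNmodMorphism.Build _ _ phi retraction_nmod.
(** Invariance of [z] carries [a] from [m] through [z] to the right end of [m \ox z]. *)
Fact retraction_rscalable (m : M) (a : R) : phi (m :* a) = phi m :* a.
Proof. by rewrite /retraction tensZ zinv -tens_rscale !rlinearZ. Qed.
HB.instance Definition _ :=
  isRScalable.Build R M N phi retraction_rscalable.
End Map.

Lemma invariant_semicosplit :
  (forall c : C, (counit C z : R) *: c = c) -> semicosplit C.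
Proof.
move=> zP.
exists (fun M N (g : comodule_hom (ind_obj C M) (ind_obj C N)) =>
          retraction g zinv : {rlinear M -> N}); split.
  move=> M M' N N' h k g; apply: rlinear_eq => m.
  (* [k] leaves through naturality of the adjunction counit, while [h] acts only on the left factor
     of [m \ox z]. *)
  apply: etrans (ind_counit_natural _ _ k _) _.
  by congr (k (ind_counit _ (g _))); exact: tensor_mapE.
move=> M N f; apply: comodule_hom_eq => t.
rewrite /= /ind_mor_fun; elim/tensor_ind: t => [m c|s t IHs IHt]; last first.
  by rewrite !tensor_mapD IHs IHt.
(* The retraction of [G(f)] sends [m] to [f m :* counit C z]; this scalar is absorbed by [c] across
   the tensor sign. *)
rewrite !tensor_mapE -[in RHS](zP c) -tensZ; congr (_ \ox c).
by rewrite -ind_counitE; congr (ind_counit N _); exact: tensor_mapE.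
Qed.

End Retraction.

End Adjunction.

Theorem theorem3p10 (R : pzRingType) (C : coring R) :
  [/\ semicosplit C <-> @regular_mor (bimod_cat R) C R^o (counit C),
      @regular_mor (bimod_cat R) C R^o (counit C) <->
        (exists z : C, bimod_invariant z /\
           forall c : C, counit C z * counit C c = counit C c)
    & forall z : C, bimod_invariant z ->
        ((forall c : C, counit C z * counit C c = counit C c) <->
         (forall c : C, (counit C z : R) *: c = c))].
Proof.
split; last by move=> z _; exact: counit_unital.
- split=> [/semicosplit_invariant|/regular_counitP] [z [zinv zP]].
    by apply/regular_counitP; exists z; split=> //; exact/counit_unital.
  by apply: (invariant_semicosplit C zinv); exact/counit_unital.
- exact: regular_counitP.
Qed.
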